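(* For every set $I$, the operations $\mathbb{R}^I\to\mathbb{R}$ that preserve integrability over every finite measure space are exactly those generated by the operations $0$, $+$, $\lor$, $\lambda(\,\cdot\,)$ (for each $\lambda\in\mathbb{R}$), $\curlyvee$ and $1$.
   Context: The listed operations on $\mathbb{R}$ are: the constants $0$ and $1$ (arity $0$), addition, binary supremum $\lor$, multiplication by the scalar $\lambda$, and the operation of countably infinite arity $\curlyvee(y,x_0,x_1,\dots)=\sup_{n\in\omega}\{x_n\land y\}$ (with $\omega=\{0,1,2,\dots\}$). Generation: for sets $\Omega,K$, a function $\tau\colon\mathbb{R}^K\to\mathbb{R}$ and $S\subseteq\mathbb{R}^\Omega$, $S$ is closed under $\tau$ if for every family $(f_i)_{i\in K}$ of elements of $S$ the function $\tau((f_i)_{i\in K})\colon x\mapsto\tau((f_i(x))_{i\in K})$ belongs to $S$. Given a set $\mathcal{C}$ of operations on $\mathbb{R}$ (of possibly different arities), a function $f\colon\mathbb{R}^I\to\mathbb{R}$ is generated by $\mathcal{C}$ if it belongs to the smallest subset of $\mathbb{R}^{\mathbb{R}^I}$ that contains all projections $\pi_i\colon\mathbb{R}^I\to\mathbb{R}$ ($i\in I$) and is closed under each element of $\mathcal{C}$. Preservation: for $p\in[1,+\infty)$ and a measure space $(\Omega,\mathcal{F},\mu)$, $\mathcal{L}^p(\mu)$ is the set of $\mathcal{F}$-measurable $f\colon\Omega\to\mathbb{R}$ with $\int_\Omega|f|^p\,d\mu<\infty$. A function $\tau\colon\mathbb{R}^I\to\mathbb{R}$ preserves $p$-integrability over every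 finite measure space if, for every measure space $(\Omega,\mathcal{F},\mu)$ with $\mu(\Omega)<\infty$, $\mathcal{L}^p(\mu)$ is closed under $\tau$. This condition does not depend on $p\in[1,+\infty)$, and $\tau$ is said to preserve integrability over every finite measure space if it holds for some (equivalently, every) $p\in[1,+\infty)$. *)

(* Defs.v *)
From HB Require Import structures.
From mathcomp Require Import all_boot all_order all_algebra.
From mathcomp Require Import all_classical all_reals all_analysis.

Set Implicit Arguments.
Unset Strict Implicit.
Unset Printing Implicit Defensive.

Import Order.TTheory GRing.Theory Num.Theory.
Import numFieldNormedType.Exports.

Local Open Scope classical_set_scope.
Local Open Scope ring_scope.

Definition closed_under (R Omega K : Type) (tau : (K -> R) -> R)
    (S : set (Omega -> R)) : Prop :=
  forall f : K -> Omega -> R, (forall i, S (f i)) ->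
    S (fun x => tau (fun i => f i x)).

Record operation (R : Type) := Operation {
  arity : Type ;
  opfun : (arity -> R) -> R }.

Definition generated (R : Type) (C : operation R -> Prop) (I : Type) :
    set ((I -> R) -> R) :=
  smallest (fun S => forall op, C op -> closed_under (@opfun R op) S)
           (range (fun (i : I) (x : I -> R) => x i)).

Section RealOperations.
Variable R : realType.

Definition op_zero : operation R := Operation (fun _ : void -> R => 0).

Definition op_one : operation R := Operation (fun _ : void -> R => 1).

Definition op_add : operation R :=
  Operation (fun x : bool -> R => x false + x true).

Definition op_join : operation R :=
  Operation (fun x : bool -> R => Num.max (x false) (x true)).

Definition op_scale (lambda : R) : operation R :=
  Operation (fun x : unit -> R => lambda * x tt).

(* The argument y sits at index [None] and x_n at index [Some n].  The set
   below is nonempty and bounded above by y, so [sup] is its true supremum. *)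
Definition op_curlyvee : operation R :=
  Operation (fun x : option nat -> R =>
    sup (range (fun n : nat => Num.min (x (Some n)) (x None)))).

Inductive truncated_riesz_op : operation R -> Prop :=
| op_zeroP : truncated_riesz_op op_zero
| op_addP : truncated_riesz_op op_add
| op_joinP : truncated_riesz_op op_join
| op_scaleP (lambda : R) : truncated_riesz_op (op_scale lambda)
| op_curlyveeP : truncated_riesz_op op_curlyvee
| op_oneP : truncated_riesz_op op_one.

End RealOperations.

(* Functions, not classes of functions up to almost-everywhere equality. *)
Definition Lp (R : realType) (d : measure_display) (T : measurableType d)
    (mu : {measure set T -> \bar R}) (p : R) : set (T -> R) :=
  [set f : T -> R | measurable_fun setT f /\
           (\int[mu]_x (`|f x| `^ p)%:E < +oo)%E].

Lemma LpE (R : realType) (d : measure_display) (T : measurableType d)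
    (mu : {measure set T -> \bar R}) (p : R) :
  1 <= p -> Lp mu p = [set f : T -> R | f \in Lfun mu p%:E].
Proof.
move=> p1; have p0 : p != 0 by rewrite gt_eqF// (lt_le_trans _ p1).
apply/seteqP; split=> f /=.
- move=> [mf foo]; rewrite inE; apply/andP; split; rewrite inE//=.
  by rewrite /finite_norm unlock; apply: poweR_lty.
- move=> /andP[]; rewrite !inE/= => mf Nf; split=> //.
  by have := poweR_lty p Nf; rewrite poweR_Lnorm.
Qed.

Definition preserves_integrability_finite (R : realType) (p : R) (I : Type)
    (tau : (I -> R) -> R) : Prop :=
  forall (d : measure_display) (T : measurableType d)
    (mu : {measure set T -> \bar R}),
    (mu setT < +oo)%E -> closed_under tau (Lp mu p).

(* Main.v *)
Require Import Defs.
From mathcomp Require Import all_boot all_order all_algebra.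
From mathcomp Require Import all_classical all_reals all_analysis.
From mathcomp Require Import measurable_realfun lra.

(** Applied to the coordinates of R^I with the product sigma-algebra and the
    zero measure, preservation says that tau is measurable, so that tau depends
    on countably many coordinates e 0, e 1, ... only.  If no bound
    |tau x| <= 2^n (1 + sum_(j < n) |x (e j)|) held, points v n violating it
    would give, on nat with the point n weighted by |tau (v n)|^-p, a finite
    measure for which every coordinate of v is p-integrable but tau o v is not.
    Conversely the sets with generated indicator form a sigma-algebra that
    contains the sets c < x i, because 1_(f > c) = sup_n 1 /\ n (f - c)^+; and
    a measurable tau with 0 <= tau <= g, g generated, is the supremum of
    q 1_(tau > q) over the rationals q >= 0, hence generated.  The general case
    follows from tau = tau^+ - tau^-. *)

Set Implicit Arguments.
Unset Strict Implicit.
Unset Printing Implicit Defensive.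

Import Order.TTheory GRing.Theory Num.Theory.
Import numFieldNormedType.Exports.

Local Open Scope classical_set_scope.
Local Open Scope ring_scope.

(** The range is nonempty and bounded by [s], so [sup] is a true least upper bound; the second
    hypothesis says that no smaller number is a bound. *)
Lemma sup_range_eq (R : realType) (u : nat -> R) (s : R) :
  (forall n, u n <= s) ->
  (forall r, r < s -> exists n, r < u n) -> sup (range u) = s.
Proof.
move=> us su; have hs : has_sup (range u).
  by split; [exists (u 0%N), 0%N|exists s => _ [n _ <-]].
apply/eqP; rewrite eq_le; apply/andP; split.
  by apply: ge_sup; [exact: hs.1|move=> _ [n _ <-]].
rewrite leNgt; apply/negP => /su[n]; rewrite ltNge => /negP; apply.
by apply: ub_le_sup; [exact: hs.2|exists n].
Qed.

(** * Closure properties of the generated operations *)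

Section generated_operations.
Variables (R : realType) (I : Type).

Local Notation gen := (generated (@truncated_riesz_op R) (I := I)).

Lemma generated_op (op : operation R) (f : arity op -> (I -> R) -> R) :
  truncated_riesz_op op -> (forall i, gen (f i)) ->
  gen (fun x => opfun (fun i => f i x)).
Proof.
move=> Cop gf S [Sc Sp]; apply: (Sc op Cop f) => i.
exact: (gf i S (conj Sc Sp)).
Qed.

Lemma generated_proj i : gen (fun x => x i).
Proof. by move=> S [_]; apply; exists i. Qed.

Lemma generated0 : gen (fun=> 0).
Proof.
by apply: (@generated_op (op_zero R) (of_void _) (op_zeroP R)); case.
Qed.

Lemma generated1 : gen (fun=> 1).
Proof.
by apply: (@generated_op (op_one R) (of_void _) (op_oneP R)); case.
Qed.

Lemma generatedD f g : gen f -> gen g -> gen (fun x => f x + g x).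
Proof.
move=> gf gg.
pose h (b : bool) := if b then g else f.
by apply: (@generated_op (op_add R) h (op_addP R)) => -[].
Qed.

Lemma generated_max f g : gen f -> gen g -> gen (fun x => Num.max (f x) (g x)).
Proof.
move=> gf gg.
pose h (b : bool) := if b then g else f.
by apply: (@generated_op (op_join R) h (op_joinP R)) => -[].
Qed.

Lemma generatedZ c f : gen f -> gen (fun x => c * f x).
Proof.
by move=> gf; apply: (@generated_op (op_scale c) (fun=> f) (op_scaleP c)).
Qed.

Lemma generatedN f : gen f -> gen (fun x => - f x).
Proof.
move=> /(generatedZ (-1)); congr (gen _).
by apply/funext => x; rewrite mulN1r.
Qed.

Lemma generatedB f g : gen f -> gen g -> gen (fun x => f x - g x).
Proof. by move=> gf gg; apply: generatedD => //; exact: generatedN. Qed.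

Lemma generated_cst c : gen (fun=> c).
Proof.
move: (generatedZ c generated1); congr (gen _).
by apply/funext => x; rewrite mulr1.
Qed.

Lemma generated_min f g : gen f -> gen g -> gen (fun x => Num.min (f x) (g x)).
Proof.
move=> /generatedN gf /generatedN gg.
move: (generatedN (generated_max gf gg)); congr (gen _).
by apply/funext => x; rewrite oppr_max !opprK.
Qed.

Lemma generated_norm f : gen f -> gen (fun x => `|f x|).
Proof.
move=> gf; move: (generated_max gf (generatedN gf)); congr (gen _).
by apply/funext => x; rewrite maxrN.
Qed.

Lemma generated_sum n (f : nat -> (I -> R) -> R) : (forall j, gen (f j)) ->
  gen (fun x => \sum_(j < n) f j x).
Proof.
move=> gf; elim: n => [|n IHn].
  by move: generated0; congr (gen _); apply/funext => x; rewrite big_ord0.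
move: (generatedD IHn (gf n)); congr (gen _).
by apply/funext => x; rewrite big_ord_recr.
Qed.

(** With [g] as the truncating argument, [op_curlyvee] leaves every [u n] unchanged because
    [u n <= f <= g]; the last hypothesis makes [f] their supremum. *)
Lemma generated_sup (u : nat -> (I -> R) -> R) f g :
  (forall n, gen (u n)) -> gen g -> (forall x, f x <= g x) ->
  (forall n x, u n x <= f x) ->
  (forall x r, r < f x -> exists n, r < u n x) -> gen f.
Proof.
move=> gu gg fg uf fu.
have := @generated_op (op_curlyvee R)
  (fun o => if o is Some n then u n else g) (op_curlyveeP R).
move=> /(_ _)/= H; have {}H := H ltac:(by case).
move: H; congr (gen _); apply/funext => x.
apply: sup_range_eq => [n|r /fu[n run]].
  by rewrite ge_min uf.
by exists n; rewrite min_l// (le_trans (uf _ _)).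
Qed.

(** * Indicators and the product sigma-algebra *)

Lemma generated_indic_gt f c : gen f -> gen \1_[set x | c < f x].
Proof.
move=> gf; pose u n x := Num.min 1 (n%:R * Num.max (f x - c) 0).
apply: (@generated_sup u _ (fun=> 1)).
- move=> n; apply: (generated_min generated1).
  have gfc := generatedB gf (generated_cst c).
  exact: (generatedZ n%:R (generated_max gfc generated0)).
- exact: generated1.
- by move=> x; rewrite indicE; case: (_ \in _).
- move=> n x; rewrite /u indicE; case: (boolP (_ \in _)) => [_|].
    by rewrite ge_min lexx.
  rewrite notin_setE/= => /negP; rewrite -leNgt => fc.
  by rewrite max_r ?subr_le0// mulr0 ge_min lexx orbT.
- move=> x r; rewrite /u indicE; case: (boolP (_ \in _)) => [|_ r0].
    (* This index exceeds the inverse of [f x - c], so the term equals 1. *)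
    rewrite inE/= => cf r1; exists (Num.bound (f x - c)^-1).
    have fc0 : 0 < f x - c by rewrite subr_gt0.
    rewrite (max_l (ltW fc0)) min_l// -ler_pdivrMr// div1r ltW//.
    by apply: archi_boundP; rewrite invr_ge0 ltW.
  by exists 0%N; rewrite mul0r min_r.
Qed.

Lemma sigma_algebra_generated_indic :
  sigma_algebra setT [set A : set (I -> R) | gen \1_A].
Proof.
split=> /=.
- by move: generated0; congr (gen _); apply/funext => x; rewrite indic0.
- move=> A gA; move: (generatedB generated1 gA); congr (gen _).
  apply/funext => x; rewrite !indicE setTD in_setC.
  by case: (x \in A); rewrite ?subrr ?subr0.
(* The indicator of a union is a supremum of indicators, all bounded by 1. *)
- move=> A gA; apply: (@generated_sup (fun n => \1_(A n)) _ (fun=> 1)) => //.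
  + exact: generated1.
  + move=> n x; rewrite !indicE; case: (boolP (x \in A n)) => // xA.
    by rewrite mem_set//; exists n => //; rewrite -inE.
  + move=> x r; rewrite indicE; case: (boolP (_ \in _)) => [|xA r0].
      rewrite inE/= => -[n _ Anx] r1.
      by exists n; rewrite indicE mem_set.
    by exists 0%N; rewrite indicE; apply: lt_le_trans r0 _; rewrite ler0n.
Qed.

(* These sets generate the product sigma-algebra on [I -> R]. *)
Definition coordinate_rays : set (set (I -> R)) :=
  [set A | exists i c, A = [set x | c < x i]].

Lemma generated_indic A : <<s coordinate_rays >> A -> gen \1_A.
Proof.
apply: (smallest_sub sigma_algebra_generated_indic) => _ [i [c ->]] /=.
by apply: generated_indic_gt; exact: generated_proj.
Qed.

Definition coordinates_measurable (tau : (I -> R) -> R) :=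
  measurable_fun setT (tau : g_sigma_algebraType coordinate_rays -> R).

Lemma coordinates_measurable_gt tau c : coordinates_measurable tau ->
  <<s coordinate_rays >> [set x | c < tau x].
Proof.
move=> mtau.
have := mtau measurableT `]c, +oo[%classic (measurable_itv _).
by rewrite setTI; congr (<<s _ >> _); apply/seteqP; split => x /=;
  rewrite in_itv/= andbT.
Qed.

(** * Measurable operations with a generated bound *)

Lemma generated_ge0_measurable tau g : (forall x, 0 <= tau x <= g x) -> gen g ->
  coordinates_measurable tau -> gen tau.
Proof.
move=> tau0g gg mtau.
(* [q] enumerates the nonnegative rationals; clamping at 0 keeps every term nonnegative, so any
   index serves for a negative [r]. *)
pose q n : R := if @unpickle rat n is Some r then Num.max 0 (ratr r) else 0.
have q0 n : 0 <= q n by rewrite /q; case: unpickle => // r; rewrite le_max lexx.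
apply: (@generated_sup (fun n x => q n * \1_[set x | q n < tau x] x) _ g) => //.
- move=> n; have /generated_indic := coordinates_measurable_gt (q n) mtau.
  exact: generatedZ.
- by move=> x; have /andP[] := tau0g x.
- move=> n x; rewrite indicE; case: (boolP (_ \in _)) => [|_].
    by rewrite inE/= mulr1 => /ltW.
  by rewrite mulr0; have /andP[] := tau0g x.
- move=> x r rtau; have [r0|r0] := ltP r 0.
    by exists 0%N; rewrite (lt_le_trans r0)// mulr_ge0.
  have [t] := rat_in_itvoo rtau; rewrite in_itv/= => /andP[rt ttau].
  exists (pickle t); rewrite /q pickleK max_r; last first.
    by rewrite (le_trans r0)// ltW.
  by rewrite indicE mem_set//= mulr1.
Qed.

Lemma generated_measurable tau g : (forall x, `|tau x| <= g x) -> gen g ->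
  coordinates_measurable tau -> gen tau.
Proof.
move=> taug gg mtau.
have pos : gen (fun x => Num.max (tau x) 0).
  apply: (@generated_ge0_measurable _ g) => //.
    move=> x; rewrite le_max lexx orbT ge_max (le_trans (ler_norm _) (taug x)).
    by rewrite (le_trans _ (taug x)).
  exact: measurable_maxr.
have neg : gen (fun x => Num.max (- tau x) 0).
  apply: (@generated_ge0_measurable _ g) => //.
    move=> x; rewrite le_max lexx orbT ge_max.
    rewrite (le_trans _ (taug x)) ?ler_normr ?lexx ?orbT//.
    by rewrite (le_trans _ (taug x)).
  by apply: measurable_maxr => //; exact: measurable_funN.
move: (generatedB pos neg); congr (gen _); apply/funext => x.
by case: (leP (tau x) 0) => h; case: (leP (- tau x) 0) => h'; lra.
Qed.

(** * Dependence on countably many coordinates *)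

(* The coordinates are enumerated with padding by [None], so that [I] may be
   empty; [oapp x 0 None] is [0]. *)
Lemma coordinates_dependence A : <<s coordinate_rays >> A ->
  exists e : nat -> option I, forall x y,
    (forall n, oapp x 0 (e n) = oapp y 0 (e n)) -> A x -> A y.
Proof.
pose S : set (set (I -> R)) := [set A | exists e : nat -> option I, forall x y,
  (forall n, oapp x 0 (e n) = oapp y 0 (e n)) -> A x -> A y].
have sS : sigma_algebra setT S.
  split.
  - by exists (fun=> None).
  (* The implication holds for all [x] and [y], so exchanging them handles the complement. *)
  - move=> B [e eB]; exists e => x y exy [_ Bx]; split=> // /(eB y x) By.
    by apply: Bx; apply: By.
  - move=> B eB; have [e {}eB] := choice eB.
    (* Coding pairs merges the countably many enumerations into one. *)
    exists (fun n => if @unpickle (nat * nat)%type n is Some (k, l) then e k l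
                     else None).
    move=> x y exy [k _ Bx]; exists k => //; apply: eB Bx => l.
    by have := exy (pickle (k, l)); rewrite pickleK.
apply: (smallest_sub sS) => _ [i [c ->]].
by exists (fun=> Some i) => x y /(_ 0%N)/= ->.
Qed.

(** Two distinct values of [tau] are separated by a rational, and each of the countably many sets of
    points where [tau] exceeds a given rational depends on countably many coordinates. *)
Lemma coordinates_measurable_dependence tau : coordinates_measurable tau ->
  exists e : nat -> option I, forall x y,
    (forall n, oapp x 0 (e n) = oapp y 0 (e n)) -> tau x = tau y.
Proof.
move=> mtau.
have /choice[e eP] : forall q : rat, exists e : nat -> option I, forall x y,
    (forall n, oapp x 0 (e n) = oapp y 0 (e n)) ->
    ratr q < tau x -> ratr q < tau y.
  by move=> q; exact: coordinates_dependence (coordinates_measurable_gt _ mtau).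
exists (fun n => if @unpickle (rat * nat)%type n is Some (q, l) then e q l
                 else None).
have le x y : (forall q l, oapp x 0 (e q l) = oapp y 0 (e q l)) ->
    tau x <= tau y.
  move=> exy; rewrite leNgt; apply/negP => /rat_in_itvoo[q].
  rewrite in_itv/= => /andP[yq qx].
  by have := lt_trans yq (eP q x y (exy q) qx); rewrite ltxx.
move=> x y exy.
have {}exy q l : oapp x 0 (e q l) = oapp y 0 (e q l).
  by have := exy (pickle (q, l)); rewrite pickleK.
by apply/eqP; rewrite eq_le !le.
Qed.

End generated_operations.

(** * Closure of L^p under the listed operations *)

Section Lp_closure.
Variables (R : realType) (d : measure_display) (T : measurableType d).
Variables (mu : {measure set T -> \bar R}) (p : R).
Hypothesis p1 : 1 <= p.

Let p0 : 0 <= p. Proof. exact: le_trans p1. Qed.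

Lemma measurable_EFin_normr_powR (f : T -> R) : measurable_fun setT f ->
  measurable_fun setT (fun x => (`|f x| `^ p)%:E).
Proof.
move=> mf; apply/measurable_EFinP.
apply: (@measurableT_comp _ _ _ _ _ _ (fun y : R => y `^ p)) => //.
exact: measurableT_comp.
Qed.

Lemma Lp_le (f g : T -> R) : Lp mu p g -> measurable_fun setT f ->
  (forall x, `|f x| <= `|g x|) -> Lp mu p f.
Proof.
move=> [mg g_fin] mf fg; split=> //; apply: le_lt_trans g_fin.
apply: ge0_le_integral => //; try exact: measurable_EFin_normr_powR.
by move=> x _; rewrite lee_fin ge0_ler_powR// ?nnegrE.
Qed.

Lemma LpD (f g : T -> R) : Lp mu p f -> Lp mu p g ->
  Lp mu p (fun x => f x + g x).
Proof.
rewrite LpE//= => fp gp.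
exact: ((@Lfun_addr_closed d T R mu p%:E p1).2 f g fp gp).
Qed.

Lemma LpZ c (f : T -> R) : Lp mu p f -> Lp mu p (fun x => c * f x).
Proof.
rewrite LpE//= => /(Lfun_scale c p1).
rewrite (_ : _ \o* f = fun x => c * f x)//.
by apply/funext => x /=; rewrite mulrC.
Qed.

Lemma Lp_norm (f : T -> R) : Lp mu p f -> Lp mu p (fun x => `|f x|).
Proof.
move=> fp; apply: (Lp_le fp) => [|x]; last by rewrite normr_id.
by apply: measurableT_comp => //; exact: fp.1.
Qed.

Lemma Lp_le2 (f g h : T -> R) : Lp mu p g -> Lp mu p h ->
  measurable_fun setT f -> (forall x, `|f x| <= `|g x| + `|h x|) -> Lp mu p f.
Proof.
move=> /Lp_norm gp /Lp_norm hp mf fgh; apply: (Lp_le (LpD gp hp)) => // x.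
by rewrite (le_trans (fgh x))// ler_norm.
Qed.

Lemma Lp_cst c : (mu setT < +oo)%E -> Lp mu p (fun=> c).
Proof.
move=> muoo; split => //; rewrite integral_cst//.
by apply: lte_mul_pinfty; rewrite ?lee_fin ?powR_ge0.
Qed.

Lemma Lp_truncated_riesz_op op : (mu setT < +oo)%E -> truncated_riesz_op op ->
  closed_under (@opfun R op) (Lp mu p).
Proof.
move=> muoo [|||c||] f fp /=.
- exact: Lp_cst.
- by apply: LpD.
- apply: (Lp_le2 (fp false) (fp true)).
    by apply: measurable_maxr; apply: (fp _).1.
  by move=> x; rewrite /Num.max; case: ifP => _; rewrite ?lerDr ?lerDl.
- exact: (LpZ c (fp tt)).
- have mf n : measurable_fun setT (fun x => Num.min (f (Some n) x) (f None x)).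
    by apply: measurable_minr; exact: (fp _).1.
  have ub x : has_ubound
      (range (fun n => Num.min (f (Some n) x) (f None x))).
    by exists (f None x) => _ [n _ <-]; rewrite ge_min lexx orbT.
  (* The supremum lies between the minimum of x_0 and y, and y itself, so |y| + |x_0| dominates
     it. *)
  apply: (Lp_le2 (fp None) (fp (Some 0%N))).
    have := @measurable_fun_sups _ T R setT
      (fun n x => Num.min (f (Some n) x) (f None x)) 0%N (fun x _ => ub x) mf.
    congr (measurable_fun _ _); apply/funext => x; rewrite /sups/sdrop/=.
    by congr sup; apply/seteqP; split => _ [n _ <-]; exists n.
  move=> x.
  have le1 : sup (range (fun n => Num.min (f (Some n) x) (f None x))) <=
      f None x.
    apply: ge_sup; first by exists (Num.min (f (Some 0%N) x) (f None x)), 0%N.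
    by move=> _ [n _ <-]; rewrite ge_min lexx orbT.
  have le0 : Num.min (f (Some 0%N) x) (f None x) <=
      sup (range (fun n => Num.min (f (Some n) x) (f None x))).
    by apply: ub_le_sup => //; exists 0%N.
  set s := sup _ in le1 le0 *.
  have := ler_norm (f None x); have := ler_norm (- f None x).
  have := ler_norm (f (Some 0%N) x); have := ler_norm (- f (Some 0%N) x).
  rewrite !normrN ler_norml; move: le0; rewrite ge_min.
  by case/orP => *; apply/andP; split; lra.
- exact: Lp_cst.
Qed.

End Lp_closure.

(** For a fixed family [f] in L^p, the operations whose composite with [f] is in L^p include the
    projections and are closed under the listed operations, hence include every generated one. *)
Lemma generated_preserves_integrability (R : realType) (p : R) (I : Type)
    (tau : (I -> R) -> R) : 1 <= p ->
  generated (@truncated_riesz_op R) tau -> preserves_integrability_finite p tau.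
Proof.
move=> p1 gtau d T mu muoo f fp.
apply: (gtau [set g | Lp mu p (fun x => g (f ^~ x))]); split => /=.
- move=> op Cop g gp.
  exact: (Lp_truncated_riesz_op p1 muoo Cop (f := fun i x => g i (f ^~ x)) gp).
- by move=> _ [i _ <-]; exact: fp.
Qed.

(** * Measurability from preservation *)

Lemma preserves_integrability_coordinates_measurable (R : realType) (p : R)
    (I : Type) (tau : (I -> R) -> R) :
  preserves_integrability_finite p tau -> coordinates_measurable tau.
Proof.
move=> ptau.
have [|i|//] := (ptau _ (g_sigma_algebraType (@coordinate_rays R I)) mzero _
  (fun i x => x i)).
  exact: ltry.
split; last by rewrite integral_measure_zero.
(* The open upper rays generate the Borel sets, and their preimages under a coordinate lie in
   [coordinate_rays]. *)
apply: (measurability _ (RGenOInfty.measurableE R)) => _ [_ [c ->] <-].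
apply: sub_sigma_algebra; exists i, c; rewrite setTI.
by apply/seteqP; split => x /=; rewrite in_itv/= andbT.
Qed.

(** * Weighted counting measures and the growth bound *)

Section weighted_counting.
Variable R : realType.

Definition weighted_counting (w : nat -> {nonneg R}) :
    {measure set nat -> \bar R} :=
  mseries (fun n => mscale (w n) (\d_ n)) 0.

Lemma ge0_integral_weighted_counting w (f : nat -> \bar R) :
  (forall n, 0 <= f n)%E ->
  (\int[weighted_counting w]_n f n = \sum_(n <oo) (w n)%:num%:E * f n)%E.
Proof.
move=> f0; rewrite ge0_integral_measure_series//.
apply: eq_eseriesr => n _.
by rewrite ge0_integral_mscale//= integral_dirac//= diracT mul1e.
Qed.

(** Comparison with a geometric series: the first [N] terms are absorbed into a constant [c] such
    that [a n <= c / 2 ^ n] for every [n]. *)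
Lemma nneseries_half_lty (a : nat -> R) N : (forall n, 0 <= a n) ->
  (forall n, (N <= n)%N -> a n <= (2 ^ n)%:R^-1) ->
  (\sum_(n <oo) (a n)%:E < +oo)%E.
Proof.
move=> a0 aN; pose c := 1 + \sum_(n < N) a n * (2 ^ n)%:R.
have c0 : 0 <= c by rewrite addr_ge0// sumr_ge0// => i _; rewrite mulr_ge0.
(* Doubling [c], shifting to [n.+1] and adding 0 give the form summed by [epsilon_trick]. *)
have ac n : a n <= 0 + (2 * c) / (2 ^ n.+1)%:R.
  have p2 : 0 < (2 ^ n)%:R :> R by rewrite ltr0n expn_gt0.
  rewrite add0r expnS natrM invfM mulrACA divff// mul1r ler_pdivlMr//.
  have [Nn|nN] := leqP N n.
    rewrite (@le_trans _ _ 1)//; last first.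
      by rewrite lerDl sumr_ge0// => i _; rewrite mulr_ge0.
    by rewrite -ler_pdivlMr// div1r aN.
  rewrite /c (bigD1 (Ordinal nN))//= addrCA lerDl addr_ge0// sumr_ge0// => i _.
  by rewrite mulr_ge0.
have c20 : 0 <= 2 * c by rewrite mulr_ge0.
apply: (@le_lt_trans _ _
  (\sum_(n <oo) (0%:E + ((2 * c) / (2 ^ n.+1)%:R)%:E)%E)%E).
  by apply: lee_nneseries => n _; rewrite ?lee_fin// -EFinD lee_fin.
apply: le_lt_trans (epsilon_trick _ _ c20) _ => //.
by rewrite eseries0// add0e ltry.
Qed.

End weighted_counting.

Lemma preserves_integrability_bound (R : realType) (p : R) (I : Type)
    (tau : (I -> R) -> R) (e : nat -> option I) : 1 <= p ->
  (forall x y, (forall n, oapp x 0 (e n) = oapp y 0 (e n)) -> tau x = tau y) ->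
  preserves_integrability_finite p tau ->
  exists n, forall x,
    `|tau x| <= (2 ^ n)%:R * (1 + \sum_(j < n) `|oapp x 0 (e j)|).
Proof.
move=> p1 etau ptau; apply: contrapT => /forallNP nb.
have p0 : 0 <= p by exact: le_trans p1.
have /choice[v vP] n : exists x,
    (2 ^ n)%:R * (1 + \sum_(j < n) `|oapp x 0 (e j)|) < `|tau x| /\
    (forall i, (forall k, e k <> Some i) -> x i = 0).
  have /existsNP[x /negP] := nb n; rewrite -ltNge => tx.
  (* Off the enumerated coordinates the point may be set to 0, which makes
     those coordinates integrable too. *)
  pose y i := if `[< exists k, e k = Some i >] then x i else 0.
  have yx k : oapp x 0 (e k) = oapp y 0 (e k).
    case ek : (e k) => [i|] //=; rewrite /y asboolT//; by exists k.
  exists y; split; last first.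
    by move=> i ei; rewrite /y asboolF// => -[k]; exact: ei.
  rewrite -(etau _ _ yx) (le_lt_trans _ tx)//.
  by under eq_bigr do rewrite -yx.
have t0 n : 0 < `|tau (v n)|.
  apply: le_lt_trans (vP n).1.
  by rewrite mulr_ge0// addr_ge0// sumr_ge0.
have w0 n : 0 <= (`|tau (v n)| `^ p)^-1 by rewrite invr_ge0 powR_ge0.
pose w n := NngNum (w0 n).
(* As [1 <= p], the factor 2^n is at most its own p-th power, which yields the decay 2^-n. *)
have small n (b : R) : 0 <= b -> (2 ^ n)%:R * b <= `|tau (v n)| ->
    (`|tau (v n)| `^ p)^-1 * b `^ p <= (2 ^ n)%:R^-1.
  move=> b0 hb; have p2 : 1 <= (2 ^ n)%:R :> R by rewrite ler1n expn_gt0.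
  rewrite mulrC ler_pdivrMr ?powR_gt0// mulrC ler_pdivlMr ?(lt_le_trans _ p2)//.
  apply: (@le_trans _ _ (((2 ^ n)%:R * b) `^ p)); last first.
    by rewrite ge0_ler_powR ?nnegrE// mulr_ge0.
  rewrite powRM// mulrC ler_wpM2r ?powR_ge0// le1r_powR//.
(* Coordinate [e j] enters the violated bound from [n = j.+1] on; only finitely many terms escape
   this control. *)
have big n j : (j < n)%N -> (2 ^ n)%:R * `|oapp (v n) 0 (e j)| <= `|tau (v n)|.
  move=> jn; apply: le_trans (ltW (vP n).1); rewrite ler_wpM2l//.
  rewrite (bigD1 (Ordinal jn))//= addrCA lerDl addr_ge0// sumr_ge0//.
have one n : (2 ^ n)%:R * 1 <= `|tau (v n)|.
  apply: le_trans (ltW (vP n).1); rewrite ler_wpM2l// lerDl sumr_ge0//.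
have [||_] := ptau _ nat (weighted_counting w) _ (fun i n => v n i).
(* The total mass is the integral of 1, finite by [small] with [b = 1]. *)
- rewrite -[X in (X < _)%E]mul1e -integral_cst//.
  rewrite ge0_integral_weighted_counting//.
  apply: (@nneseries_half_lty _ _ 0) => [n|n _]; first by rewrite mulr_ge0.
  by have := small n 1 ler01 (one n); rewrite powR1.
- move=> i; split=> //.
  rewrite ge0_integral_weighted_counting; last first.
    by move=> n; rewrite lee_fin powR_ge0.
  have [[j ej]|/forallNP ei] := pselect (exists k, e k = Some i).
    apply: (@nneseries_half_lty _ _ j.+1) => [n|n jn].
      by rewrite mulr_ge0// powR_ge0.
    by apply: small => //; have := big n j jn; rewrite ej.
  apply: (@nneseries_half_lty _ _ 0) => [n|n _].
    by rewrite mulr_ge0// powR_ge0.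
  by apply: small => //; rewrite (vP n).2// normr0 mulr0.
rewrite ge0_integral_weighted_counting; last first.
    by move=> n; rewrite lee_fin powR_ge0.
(* Each weight cancels the p-th power of |tau (v n)|, leaving a series of ones. *)
under eq_eseriesr.
  move=> n _; rewrite -EFinM /= mulVf ?gt_eqF ?powR_gt0//; over.
move=> h.
(* The series exceeds every natural number, so its finiteness contradicts the Archimedean
   property. *)
have hk k : (k%:R%:E <= \sum_(n <oo) (1 : \bar R))%E.
  apply: le_trans (@nneseries_lim_ge _ _ xpredT 0 k _) => //.
  by rewrite sumEFin big_const_nat subn0 iter_addr addr0.
have hf : (\sum_(n <oo) (1 : \bar R))%E \is a fin_num.
  by rewrite ge0_fin_numE// (le_trans _ (hk 0%N)).
move: hk; rewrite -(fineK hf) => hk.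
have := hk (Num.bound (fine (\sum_(n <oo) (1 : \bar R))%E)).
rewrite lee_fin leNgt archi_boundP//.
have := hk 0%N; by rewrite lee_fin.
Qed.

Theorem theorem2p4 (R : realType) (p : R) (hp : 1 <= p) (I : Type)
    (tau : (I -> R) -> R) :
  preserves_integrability_finite p tau <->
  generated (@truncated_riesz_op R) tau.
Proof.
split=> [ptau|]; last exact: generated_preserves_integrability.
have mtau := preserves_integrability_coordinates_measurable ptau.
have [e etau] := coordinates_measurable_dependence mtau.
have [n bound] := preserves_integrability_bound hp etau ptau.
(* The growth bound is itself generated, as it involves finitely many coordinates; the padding
   [None] contributes the constant 0. *)
apply: (generated_measurable bound) => //.
apply: generatedZ; apply: generatedD; first exact: generated1.
apply: (@generated_sum _ _ _ (fun j x => `|oapp x 0 (e j)|)) => j.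
apply: generated_norm; case: (e j) => [i|]; first exact: generated_proj.
exact: generated0.
Qed.
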